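(* Let $n$ be a natural number. If there exists a system $\Sigma$ which is base-complete over $\models^s_n$ and base-sound over $\models^\alpha_n$, then for all finite sets of formulas $\Gamma$ and all formulas $A$: $\Gamma\models^s_nA$ if and only if $\Gamma\models^\alpha_nA$.
   Context: LANGUAGE. $\mathscr{L}$ is the propositional language whose formulas are built from infinitely many propositional letters and the atomic constant $\bot$ by $\wedge,\vee,\rightarrow$; $\neg X := X \rightarrow \bot$. $\mathrm{ATOM}$ is the set of the letters together with $\bot$. $\Gamma,\Delta$ always range over finite sets of formulas. ATOMIC RULES. A rule of level $0$ is an atom (an axiom). A rule of level $1$ infers an atom $A$ from atoms $A_1,\dots,A_m$. For $k\ge 1$, if $\Re_1,\dots,\Re_m$ are finite sets of atomic rules (some possibly empty) of maximal level $k-1$, then $([\Re_1]A_1,\dots,[\Re_m]A_m)/A$, which infers the atom $A$ from the atoms $A_1,\dots,A_m$ and discharges the rules in $\Re_i$ in the derivation of the $i$-th premise, is a rule of level $k+1$. ATOMIC BASES. An atomic base is a (possibly infinite) set $\mathfrak{B}$ of atomic rules containing the explosion rule $\bot/A$ for every atom $A$; its level is the maximal level of its rules other than the explosion rules ($0$ if there are none). $\mathbb{B}^n$ is the set of bases of level $\le n$. $\mathfrak{C}\supseteq_n\mathfrak{B}$ means $\mathfrak{C}\supseteq\mathfrak{B}$ and $\mathfrak{C}\in\mathbb{B}^n$. Derivations in $\mathfrak{B}$ are defined inductively: an atom $A$ is a single-node derivation of $A$, from no assumed rules if the axiom $A\in\mathfrak{B}$ is applied, and from the assumed rule $A$ if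 $A$ is assumed; if $\mathscr{D}_i$ derives $A_i$ from assumed rules $\mathfrak{C}_i\cup\Re_i$ ($i\le m$), then applying $R=([\Re_1]A_1,\dots,[\Re_m]A_m)/A$ yields a derivation of $A$ from $\bigcup_i\mathfrak{C}_i$ if $R\in\mathfrak{B}$, and from $\bigcup_i\mathfrak{C}_i\cup\{R\}$ if $R\notin\mathfrak{B}$. $\vdash_{\mathfrak{B}}A$ means that there is a derivation of $A$ in $\mathfrak{B}$ from no assumed rules (a closed derivation). SANDQVIST'S BASE SEMANTICS. For $\mathfrak{B}\in\mathbb{B}^n$, define: for $A\in\mathrm{ATOM}$, $\models^s_{\mathfrak{B},n}A$ iff $\vdash_{\mathfrak{B}}A$; $\models^s_{\mathfrak{B},n}B\wedge C$ iff $\models^s_{\mathfrak{B},n}B$ and $\models^s_{\mathfrak{B},n}C$; $\models^s_{\mathfrak{B},n}B\vee C$ iff for all $\mathfrak{C}\supseteq_n\mathfrak{B}$ and all $D\in\mathrm{ATOM}$, if $B\models^s_{\mathfrak{C},n}D$ and $C\models^s_{\mathfrak{C},n}D$ then $\models^s_{\mathfrak{C},n}D$; $\models^s_{\mathfrak{B},n}B\rightarrow C$ iff $B\models^s_{\mathfrak{B},n}C$; for $\Gamma\ne\emptyset$, $\Gamma\models^s_{\mathfrak{B},n}A$ iff for all $\mathfrak{C}\supseteq_n\mathfrak{B}$, if $\models^s_{\mathfrak{C},n}B$ for all $B\in\Gamma$ then $\models^s_{\mathfrak{C},n}A$. $\Gamma\models^s_nA$ iff $\Gamma\models^s_{\mathfrak{B},n}A$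 for all $\mathfrak{B}\in\mathbb{B}^n$. REDUCIBILITY SEMANTICS. An argument structure $\mathscr{D}=\langle T,\langle f,h,g\rangle\rangle$ consists of a finite rooted tree $T$ with nodes labelled by formulas ($\mu\prec\nu$ means that $\nu$ lies below $\mu$, towards the root), whose leaves are partitioned into assumption leaves $\mathrm{as}(T)$ and axiom leaves $\mathrm{ax}(T)$, and of partial discharge functions: $f$ is defined on a subset of $\mathrm{as}(T)$ with $\mu\prec f(\mu)$; $h$ is defined on a subset of $\mathrm{ax}(T)$ with $\mu\prec h(\mu)$, where $h(\mu)$ and its children are labelled by atoms and $h(\mu)$ is not a value of $f$; $g$ is defined on a set of sets $K$ of edges, each $K$ consisting of all and only the edges linking a node $\mu_K$ to its children, where $\mu_K$ and its children are labelled by atoms, $\mu_K$ is not a value of $f$, $\mu_K\prec g(K)$, $g(K)$ and its children are labelled by atoms, and $g(K)$ is not a value of $f$. ($f$ discharges assumptions; $h$ and $g$ discharge assumed atomic rules of level $0$ and higher.) The root label is the conclusion. $\mathscr{D}$ is from $\Gamma$ to $A$ if $\Gamma$ is the set of its undischarged assumptions and $A$ its conclusion; it is closed if $\Gamma=\emptyset$, open otherwise. Derivations in $\mathfrak{B}$ are regarded as argument structures with all labels atomic and $f$ empty. $\mathscr{D}[\mathscr{D}^{**}/\mathscr{D}^*]$ is the result of replacing the sub-structure $\mathscr{D}^*$ by $\mathscr{D}^{**}$ in $\mathscr{D}$, the discharge functions being redefined in the natural way (discharges of surviving or copied assumptions and assumed rules take place at the corresponding nodes; the others disappear). If $\mathscr{D}$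 is from $\Gamma=\{\mu_1,\dots,\mu_m\}$ and $\sigma$ assigns to each $\mu_i$ an argument structure $\sigma(\mu_i)$ with the same conclusion as $\mu_i$, then $\mathscr{D}^\sigma=\mathscr{D}[\sigma(\mu_1),\dots,\sigma(\mu_m)/\mu_1,\dots,\mu_m]$; it is a closed $\sigma$-instance if all $\sigma(\mu_i)$ are closed. An inference is a triple $\langle\langle\mathscr{D}_1,\dots,\mathscr{D}_m\rangle,A,\delta\rangle$ with $\delta$ an extension of the discharge functions of the $\mathscr{D}_i$; its associated argument structure joins the trees of the $\mathscr{D}_i$ by a new root $A$ and adds the discharges $\delta$. A rule is a (recursive) set of inferences, its instances. Introduction rules are Gentzen's: $A,B/A\wedge B$; $A_i/A_1\vee A_2$ ($i=1,2$); $[A]B/A\rightarrow B$. $\mathscr{D}$ is canonical if it is associated to an instance of an introduction rule. A reduction for a rule $R$ is a map $\phi$ from and to argument structures, defined on some set $\mathbb{D}$ of argument structures associated to instances of $R$, such that for all $\mathscr{D}\in\mathbb{D}$: (a) if $\mathscr{D}$ is from $\Gamma$ to $A$, then $\phi(\mathscr{D})$ is from some $\Gamma^*\subseteq\Gamma$ to $A$; (b) for all $\sigma$, $\phi$ is defined on $\mathscr{D}^\sigma$ and $\phi(\mathscr{D}^\sigma)=\phi(\mathscr{D})^\sigma$. For a set $\mathfrak{J}$ of reductions, $\mathscr{D}\leq_{\mathfrak{J}}\mathscr{D}^*$ is the reflexive-transitive closure of: $\mathscr{D}^*=\mathscr{D}[\phi(\mathscr{D}^{**})/\mathscr{D}^{**}]$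 for some sub-structure $\mathscr{D}^{**}$ of $\mathscr{D}$ and some $\phi\in\mathfrak{J}$. An argument is a pair $\langle\mathscr{D},\mathfrak{J}\rangle$. It is $n$-valid on $\mathfrak{B}\in\mathbb{B}^n$ iff: when $\mathscr{D}$ is closed with atomic conclusion, $\mathscr{D}\leq_{\mathfrak{J}}\mathscr{D}^*$ for some closed derivation $\mathscr{D}^*$ in $\mathfrak{B}$; when $\mathscr{D}$ is closed with non-atomic conclusion, $\mathscr{D}\leq_{\mathfrak{J}}\mathscr{D}^*$ for some canonical $\mathscr{D}^*$ whose immediate sub-structures, paired with $\mathfrak{J}$, are $n$-valid on $\mathfrak{B}$; when $\mathscr{D}$ is open with undischarged assumptions $\Gamma$, for all $\sigma$ assigning closed structures, all sets of reductions $\mathfrak{J}^+\supseteq\mathfrak{J}$ and all $\mathfrak{C}\supseteq_n\mathfrak{B}$, if $\langle\sigma(\mu),\mathfrak{J}^+\rangle$ is $n$-valid on $\mathfrak{C}$ for all $\mu\in\Gamma$, then $\langle\mathscr{D}^\sigma,\mathfrak{J}^+\rangle$ is $n$-valid on $\mathfrak{C}$. $\Gamma\models^\alpha_{\mathfrak{B},n}A$ means that some argument $\langle\mathscr{D},\mathfrak{J}\rangle$ with $\mathscr{D}$ from $\Gamma$ to $A$ is $n$-valid on $\mathfrak{B}$. An argument is $n$-valid iff it is $n$-valid on every $\mathfrak{B}\in\mathbb{B}^n$; $\Gamma\models^\alpha_nA$ means that there is an $n$-valid argument $\langle\mathscr{D},\mathfrak{J}\rangle$ with $\mathscr{D}$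 from $\Gamma$ to $A$. SYSTEMS. A system $\Sigma$ is a recursive set of super-intuitionistic rules over $\mathscr{L}$ (e.g. intuitionistic logic $\mathrm{IL}$); $\Gamma\vdash_\Sigma A$ is derivability in $\Sigma$. Extended derivations of $\Sigma$ are built inductively from single formulas (assumed, or, for atoms, possibly used as axioms) by the logical rules of $\Sigma$ in the standard way and by applications of arbitrary atomic rules $([\Re_1]A_1,\dots,[\Re_m]A_m)/B$, which discharge the rules $\Re_i$ used in the derivation of the $i$-th premise. $\Gamma\vdash_{\Sigma\cup\mathfrak{B}}A$ means that there is an extended derivation of $\Sigma$ from $\Gamma$ to $A$ whose only additional (undischarged) atomic rules are those in $\mathfrak{B}$. Let $\Vdash_n$ be $\models^\alpha_n$ or $\models^s_n$. $\Sigma$ is base-complete over $\Vdash_n$ iff for all $\mathfrak{B}\in\mathbb{B}^n$, $\Gamma$ and $A$, $\Gamma\Vdash_{\mathfrak{B},n}A$ implies $\Gamma\vdash_{\Sigma\cup\mathfrak{B}}A$; it is base-sound over $\Vdash_n$ iff for all $\mathfrak{B}\in\mathbb{B}^n$, $\Gamma$ and $A$, $\Gamma\vdash_{\Sigma\cup\mathfrak{B}}A$ implies $\Gamma\Vdash_{\mathfrak{B},n}A$. *)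

(* Defs.v *)
From HB Require Import structures.
From Stdlib Require Import Setoid.
From Stdlib Require Relation_Operators.
From mathcomp Require Import all_boot.

Set Implicit Arguments.
Unset Strict Implicit.
Unset Printing Implicit Defensive.

(** * Language *)

Inductive atom := Letter of nat | Bot.

Inductive formula :=
| Atom of atom
| And of formula & formula
| Or of formula & formula
| Imp of formula & formula.

Definition atomic (A : formula) : bool := if A is Atom _ then true else false.

Definition atom_code (a : atom) : option nat := if a is Letter p then Some p else None.
Definition atom_decode (c : option nat) : atom := if c is Some p then Letter p else Bot.
Lemma atom_codeK : cancel atom_code atom_decode. Proof. by case. Qed.
HB.instance Definition _ := Countable.copy atom (can_type atom_codeK).

Fixpoint formula_code (A : formula) : GenTree.tree atom :=
  match A with
  | Atom a => GenTree.Leaf a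
  | And A1 A2 => GenTree.Node 0 [:: formula_code A1; formula_code A2]
  | Or A1 A2 => GenTree.Node 1 [:: formula_code A1; formula_code A2]
  | Imp A1 A2 => GenTree.Node 2 [:: formula_code A1; formula_code A2]
  end.

Fixpoint formula_decode (c : GenTree.tree atom) : option formula :=
  match c with
  | GenTree.Leaf a => Some (Atom a)
  | GenTree.Node i [:: c1; c2] =>
      match formula_decode c1, formula_decode c2 with
      | Some A1, Some A2 =>
          match i with
          | 0 => Some (And A1 A2)
          | 1 => Some (Or A1 A2)
          | _ => Some (Imp A1 A2)
          end
      | _, _ => None
      end
  | _ => None
  end.

Lemma formula_codeK : pcancel formula_code formula_decode.
Proof. by elim=> //= A1 -> A2 ->. Qed.
HB.instance Definition _ := Countable.copy formula (pcan_type formula_codeK).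

(** * Recursive sets *)

(** Codes of partial recursive functions, on argument lists of any length
    (a projection outside of the list gives 0). *)
Inductive recfun :=
| RZero
| RSucc
| RProj of nat
| RComp of recfun & seq recfun
| RPrim of recfun & recfun
| RMin of recfun.

Inductive computes : recfun -> seq nat -> nat -> Prop :=
| computes_zero v : computes RZero v 0
| computes_succ x v : computes RSucc (x :: v) x.+1
| computes_proj i v : computes (RProj i) v (nth 0 v i)
| computes_comp f gs v ws y :
    size gs = size ws ->
    (forall i, i < size gs -> computes (nth RZero gs i) v (nth 0 ws i)) ->
    computes f ws y -> computes (RComp f gs) v y
| computes_prim0 f g v y :
    computes f v y -> computes (RPrim f g) (0 :: v) y
| computes_primS f g x v y z :
    computes (RPrim f g) (x :: v) y -> computes g [:: x, y & v] z ->
    computes (RPrim f g) (x.+1 :: v) z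
| computes_min f v x :
    computes f (x :: v) 0 ->
    (forall i, i < x -> exists y, computes f (i :: v) y.+1) ->
    computes (RMin f) v x.

(** The Goedel numbering is [pickle], which is effective on all the types
    used below. *)
Definition recursive (T : countType) (P : T -> Prop) : Prop :=
  exists r, forall x, (P x /\ computes r [:: pickle x] 1) \/
                      (~ P x /\ computes r [:: pickle x] 0).

(** * Atomic rules and bases *)

(** [Rule [:: (Rs1, A1); ...; (Rsm, Am)] A] is ([Rs1]A1, ..., [Rsm]Am)/A;
    [Rule [::] A] is the axiom A.  The finite sets Rsi are given by lists. *)
Inductive arule := Rule of seq (seq arule * atom) & atom.

Fixpoint arule_code (R : arule) : GenTree.tree atom :=
  let: Rule ps a := R in
  GenTree.Node 0 (GenTree.Leaf a ::
    [seq GenTree.Node 0 (GenTree.Leaf x.2 :: [seq arule_code Q | Q <- x.1]) | x <- ps]).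

Fixpoint arule_decode (c : GenTree.tree atom) : option arule :=
  if c is GenTree.Node _ (GenTree.Leaf a :: cs) then
    Some (Rule (pmap (fun d => if d is GenTree.Node _ (GenTree.Leaf b :: ds)
                               then Some (pmap arule_decode ds, b) else None) cs) a)
  else None.

Lemma arule_codeK : pcancel arule_code arule_decode.
Proof.
rewrite /pcancel; fix IH 1 => -[ps a] /=; congr (Some (Rule _ a)).
elim: ps => //= -[Rs b] ps -> /=; congr ((_, b) :: ps).
by elim: Rs => //= R Rs ->; rewrite IH.
Qed.
HB.instance Definition _ := Countable.copy arule (pcan_type arule_codeK).

Fixpoint level (R : arule) : nat :=
  let: Rule ps _ := R in
  if ps is [::] then 0
  else foldr maxn 1 [seq foldr maxn 0 [seq (level Q).+2 | Q <- x.1] | x <- ps].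

(** Equality of rules when the lists of discharged rules are read as sets. *)
Inductive same_rule : arule -> arule -> Prop :=
| SameRule (ps qs : seq (seq arule * atom)) a :
    unzip2 ps = unzip2 qs ->
    (forall x, x \in zip ps qs ->
       forall R, R \in x.1.1 -> exists2 Q, Q \in x.2.1 & same_rule R Q) ->
    (forall x, x \in zip ps qs ->
       forall Q, Q \in x.2.1 -> exists2 R, R \in x.1.1 & same_rule R Q) ->
    same_rule (Rule ps a) (Rule qs a).

Definition explosion (a : atom) : arule := Rule [:: ([::], Bot)] a.

Definition base := arule -> Prop.

Definition is_base (B : base) : Prop :=
  (forall a, B (explosion a)) /\ (forall R Q, same_rule R Q -> B R -> B Q).

Definition in_bases (n : nat) (B : base) : Prop :=
  is_base B /\ forall R, B R -> (forall a, R <> explosion a) -> level R <= n.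

Definition extends (n : nat) (C B : base) : Prop :=
  (forall R, B R -> C R) /\ in_bases n C.

(** * Argument structures *)

(** Every discharge goes from a node to a node on its path to the root, so it
    is stored at the source as the number of steps towards the root: [0] is the
    parent, [1] the grandparent, and so on.
    - [Asm A k]: assumption leaf labelled A; f sends it to its ancestor number
      [k] when there is one.
    - [Node A p ts]: node with children [ts], an axiom leaf if [ts = [::]];
      for [p = Some k], h (if [ts = [::]]) or g (otherwise, on the edges to the
      children) sends it to its ancestor number [k] when there is one.
    A pointer beyond the root is not a discharge.  It names the assumption, or
    assumed rule, which is undischarged in the structure but may be discharged
    in a larger one: hence sub-structures are subterms, they are replaced by
    literal replacement, and a copy has the name of its original. *)
Inductive struct :=
| Asm of formula & nat
| Node of formula & option nat & seq struct.

Fixpoint struct_code (D : struct) : GenTree.tree (formula * (nat + option nat)) :=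
  match D with
  | Asm A k => GenTree.Leaf (A, inl k)
  | Node A p ts => GenTree.Node 0 (GenTree.Leaf (A, inr p) :: [seq struct_code t | t <- ts])
  end.

Fixpoint struct_decode (c : GenTree.tree (formula * (nat + option nat))) : option struct :=
  match c with
  | GenTree.Leaf (A, inl k) => Some (Asm A k)
  | GenTree.Node _ (GenTree.Leaf (A, inr p) :: cs) => Some (Node A p (pmap struct_decode cs))
  | _ => None
  end.

Lemma struct_codeK : pcancel struct_code struct_decode.
Proof.
rewrite /pcancel; fix IH 1 => -[A k|A p ts] //=; congr (Some (Node A p _)).
by elim: ts => //= t ts ->; rewrite IH.
Qed.
HB.instance Definition _ := Countable.copy struct (pcan_type struct_codeK).

Definition concl (D : struct) : formula :=
  match D with Asm A _ => A | Node A _ _ => A end.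

Definition children (D : struct) : seq struct :=
  if D is Node _ _ ts then ts else [::].

(** [undischarged D u k A]: the node [u] of D (the list of the branches taken
    from the root) is an undischarged assumption leaf labelled A, with name k. *)
Inductive undischarged : struct -> seq nat -> nat -> formula -> Prop :=
| undischarged_leaf A k : undischarged (Asm A k) [::] k A
| undischarged_node B p ts i t u k A :
    onth ts i = Some t -> undischarged t u k.+1 A ->
    undischarged (Node B p ts) (i :: u) k A.

(** D has an undischarged axiom leaf or rule application with name k. *)
Inductive undischarged_rule : struct -> nat -> Prop :=
| undischarged_rule_root A k ts : undischarged_rule (Node A (Some k) ts) k
| undischarged_rule_node A p ts t k :
    t \in ts -> undischarged_rule t k.+1 -> undischarged_rule (Node A p ts) k.

(** The root discharges no assumption, and it and its children are atoms. *)
Definition atomic_step (A : formula) (ts : seq struct) : Prop :=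
  [/\ atomic A, forall t, t \in ts -> atomic (concl t)
    & forall t u F, t \in ts -> ~ undischarged t u 0 F].

Inductive wf : struct -> Prop :=
| wf_asm A k : wf (Asm A k)
| wf_node A p ts :
    (forall t, t \in ts -> wf t) ->
    ((exists2 t, t \in ts & undischarged_rule t 0) -> atomic_step A ts) ->
    (p <> None -> ts <> [::] -> atomic_step A ts) ->
    wf (Node A p ts).

Definition from_to (D : struct) (G : seq formula) (A : formula) : Prop :=
  (forall F, F \in G <-> exists u k, undischarged D u k F) /\ concl D = A.

Definition closed (D : struct) : Prop := forall u k F, ~ undischarged D u k F.

(** [replaced E E' D D']: D' is D[E'/E], for one occurrence of E in D. *)
Inductive replaced (E E' : struct) : struct -> struct -> Prop :=
| replaced_here : replaced E E' E E'
| replaced_in A p ts1 ts2 t t' :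
    replaced E E' t t' ->
    replaced E E' (Node A p (ts1 ++ t :: ts2)) (Node A p (ts1 ++ t' :: ts2)).

(** In the next three functions [d] is the number of nodes below the root of
    the argument that belong to the structure on which the function was called. *)

(** Adds [m] to the pointers beyond the root. *)
Fixpoint lift (m d : nat) (D : struct) : struct :=
  let up k := if k < d then k else k + m in
  match D with
  | Asm A k => Asm A (up k)
  | Node A p ts => Node A (omap up p) [seq lift m d.+1 t | t <- ts]
  end.

Definition mapi (T U : Type) (f : nat -> T -> U) : nat -> seq T -> seq U :=
  fix loop i ts := if ts is t :: ts' then f i t :: loop i.+1 ts' else [::].

(** Replaces the undischarged assumption leaf at node u with name k and
    label A by [s u k A]. *)
Fixpoint subst (s : seq nat -> nat -> formula -> struct) (d : nat) (D : struct) : struct :=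
  match D with
  | Asm A k => if k < d then D else lift d 0 (s [::] (k - d) A)
  | Node A p ts =>
      Node A p (mapi (fun i t => subst (fun u => s (i :: u)) d.+1 t) 0 ts)
  end.

(** Changes the names of the undischarged assumptions by [r] and of the
    undischarged rules by [q]; [None] deletes the pointer. *)
Fixpoint rename (r : nat -> nat) (q : nat -> option nat) (d : nat) (D : struct) : struct :=
  match D with
  | Asm A k => Asm A (if k < d then k else d + r (k - d))
  | Node A p ts =>
      Node A (obind (fun k => if k < d then Some k else omap (addn d) (q (k - d))) p)
           [seq rename r q d.+1 t | t <- ts]
  end.

(** D^s for an assignment to the undischarged assumption nodes, and for an
    assignment to their names, i.e. one that agrees on copies.  The latter is
    what can be transported from D to [phi D] for a reduction phi; it is an
    arbitrary assignment to the nodes when these have distinct names. *)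
Definition instance (D : struct) (s : seq nat -> struct) : struct :=
  subst (fun u _ _ => s u) 0 D.
Definition name_instance (D : struct) (s : nat -> formula -> struct) : struct :=
  subst (fun _ => s) 0 D.

(** [derivation B l D]: D is a derivation in B from assumed rules which all
    have names; those with name k belong to [nth [::] l k].  A node carries the
    rule [Rule ps a] applied there; the rules discharged above its i-th premise
    are among those in the i-th component of [ps], possibly vacuously.  A
    discharged rule may happen to be in B, so that a derivation in B is also one
    in every larger base. *)
Inductive derivation (B : base) : seq (seq arule) -> struct -> Prop :=
| derivation_rule l ps a p ts :
    (if p is Some k then is_true (Rule ps a \in nth [::] l k) else B (Rule ps a)) ->
    [seq concl t | t <- ts] = [seq Atom x.2 | x <- ps] ->
    (forall x, x \in zip ps ts -> derivation B (x.1.1 :: l) x.2) ->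
    derivation B l (Node (Atom a) p ts).

Definition closed_derivation (B : base) (D : struct) : Prop := derivation B [::] D.

Definition derivable (B : base) (a : atom) : Prop :=
  exists2 D, closed_derivation B D & concl D = Atom a.

(** * Sandqvist's semantics *)

Fixpoint s_true (n : nat) (A : formula) (B : base) : Prop :=
  match A with
  | Atom a => derivable B a
  | And A1 A2 => s_true n A1 B /\ s_true n A2 B
  | Or A1 A2 =>
      forall C, extends n C B -> forall a : atom,
        (forall E, extends n E C -> s_true n A1 E -> derivable E a) ->
        (forall E, extends n E C -> s_true n A2 E -> derivable E a) ->
        derivable C a
  | Imp A1 A2 => forall C, extends n C B -> s_true n A1 C -> s_true n A2 C
  end.

Definition s_entails_on (n : nat) (B : base) (G : seq formula) (A : formula) : Prop :=
  if G is [::] then s_true n A B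
  else forall C, extends n C B -> (forall F, F \in G -> s_true n F C) -> s_true n A C.

Definition s_entails (n : nat) (G : seq formula) (A : formula) : Prop :=
  forall B, in_bases n B -> s_entails_on n B G A.

(** * Rules, reductions and validity *)

(** An inference <<D1, ..., Dm>, A, delta> is identified with its associated
    structure [Node A p [:: D1; ...; Dm]], delta being given by the pointers. *)
Definition is_inference (D : struct) : Prop :=
  wf D /\ exists A p ts, D = Node A p ts.

Definition is_rule (R : struct -> Prop) : Prop :=
  recursive R /\ forall D, R D -> is_inference D.

Definition no_discharge (D : struct) : Prop :=
  (forall u F, ~ undischarged D u 0 F) /\ ~ undischarged_rule D 0.

Inductive canonical : struct -> Prop :=
| canonical_and D1 D2 :
    no_discharge D1 -> no_discharge D2 ->
    canonical (Node (And (concl D1) (concl D2)) None [:: D1; D2])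
| canonical_orl D1 A2 :
    no_discharge D1 -> canonical (Node (Or (concl D1) A2) None [:: D1])
| canonical_orr A1 D2 :
    no_discharge D2 -> canonical (Node (Or A1 (concl D2)) None [:: D2])
| canonical_imp A D1 :
    (forall u F, undischarged D1 u 0 F -> F = A) -> ~ undischarged_rule D1 0 ->
    canonical (Node (Imp A (concl D1)) None [:: D1]).

(** An assumption of [phi D] is traced to assumptions of D by its name; the last
    clause expresses that names serve only that purpose: neither whether [phi]
    is defined nor its value depends on them. *)
Record reduction_for (R : struct -> Prop) (phi : struct -> option struct) : Prop := {
  reduction_dom : forall D E, phi D = Some E -> R D /\ wf E;
  reduction_from_to : forall D E, phi D = Some E ->
    concl E = concl D /\
    (forall k F, (exists u, undischarged E u k F) -> exists u, undischarged D u k F);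
  reduction_instance : forall D E, phi D = Some E ->
    forall s, (forall k F, wf (s k F) /\ concl (s k F) = F) ->
    phi (name_instance D s) = Some (name_instance E s);
  reduction_rename : forall D, wf D -> forall r q,
    phi (rename r q 0 D) = omap (rename r q 0) (phi D)
}.

Definition reduction (phi : struct -> option struct) : Prop :=
  exists2 R, is_rule R & reduction_for R phi.

Definition redset := (struct -> option struct) -> Prop.

Definition is_redset (J : redset) : Prop := forall phi, J phi -> reduction phi.

Definition red_step (J : redset) (D D' : struct) : Prop :=
  exists phi E E', [/\ J phi, phi E = Some E' & replaced E E' D D'].

Definition reduces (J : redset) : struct -> struct -> Prop :=
  Relation_Operators.clos_refl_trans struct (red_step J).

(** Validity of [D] given a notion [V F] of validity of closed structures for
    the formulas F in the assumptions, and [W] for the conclusion. *)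
Definition valid_from (n : nat) (V : formula -> base -> redset -> struct -> Prop)
    (W : base -> redset -> struct -> Prop) (B : base) (J : redset) (D : struct) : Prop :=
  (closed D -> W B J D) /\
  (~ closed D ->
     forall (s : seq nat -> struct) (J' : redset) (C : base),
       (forall phi, J phi -> J' phi) -> is_redset J' -> extends n C B ->
       (forall u k F, undischarged D u k F ->
          [/\ wf (s u), closed (s u), concl (s u) = F & V F C J' (s u)]) ->
       W C J' (instance D s)).

(** Validity of closed structures with conclusion A, by recursion on A.  The
    lemmas [nvalid_atomic], [nvalid_nonatomic] and [nvalid_open] below are the
    three clauses of the simultaneous definition for closed and open
    structures. *)
Fixpoint closed_valid (n : nat) (A : formula) (B : base) (J : redset) (D : struct) : Prop :=
  match A with
  | Atom _ => exists2 D', reduces J D D' & closed_derivation B D'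
  | And A1 A2 => exists D1 D2,
      let D' := Node A None [:: D1; D2] in
      [/\ reduces J D D', canonical D', closed_valid n A1 B J D1
        & closed_valid n A2 B J D2]
  | Or A1 A2 => exists D1,
      let D' := Node A None [:: D1] in
      [/\ reduces J D D', canonical D'
        & (concl D1 = A1 /\ closed_valid n A1 B J D1) \/
          (concl D1 = A2 /\ closed_valid n A2 B J D1)]
  | Imp A1 A2 => exists D1,
      let D' := Node A None [:: D1] in
      [/\ reduces J D D', canonical D'
        & valid_from n (fun=> closed_valid n A1) (closed_valid n A2) B J D1]
  end.

Definition nvalid (n : nat) (B : base) (J : redset) (D : struct) : Prop :=
  valid_from n (closed_valid n) (closed_valid n (concl D)) B J D.

Lemma onth_mapi (T U : Type) (f : nat -> T -> U) ts m i :
  onth (mapi f m ts) i = omap (f (m + i)) (onth ts i).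
Proof.
elim: ts m i => [|t ts IH] m [|i] //=; first by rewrite addn0.
by rewrite IH addSnnS.
Qed.

Lemma undischarged_asmP A j u k F :
  undischarged (Asm A j) u k F -> [/\ u = [::], k = j & F = A].
Proof. by move=> H; inversion H. Qed.

Lemma undischarged_nodeP A p ts u k F : undischarged (Node A p ts) u k F ->
  exists i t v, [/\ u = i :: v, onth ts i = Some t & undischarged t v k.+1 F].
Proof. by move=> H; inversion H; subst; do 3 eexists; split; eauto. Qed.

Lemma undischarged_lift m D u d k F : undischarged (lift m d D) u k F ->
  (k < d /\ undischarged D u k F) \/ (exists2 k', undischarged D u k' F & d <= k').
Proof.
elim: u D d k => [|i u IH] [A j|A p ts] d k /=.
- case/undischarged_asmP=> _ -> ->; case: (ltnP j d) => h; [left|right; exists j] => //.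
    by split=> //; constructor.
  exact: undischarged_leaf.
- by case/undischarged_nodeP=> ? [? [? []]].
- by case/undischarged_asmP.
- case/undischarged_nodeP=> _ [t [_ [[<- <-]]]].
  rewrite onth_map; case E: (onth ts i) => [t'|] //= [<-] /IH[[lt h]|[[|k'] h le]] //.
    by left; split=> //; econstructor; eauto.
  by right; exists k' => //; econstructor; eauto.
Qed.

Lemma closed_lift m D : closed D -> closed (lift m 0 D).
Proof.
by move=> cl u k F /undischarged_lift[[]|[k' /cl]].
Qed.

Lemma undischarged_subst D s d u k F :
  (forall v j A, undischarged D v (d + j) A -> closed (s v j A)) ->
  undischarged (subst s d D) u k F -> k < d /\ undischarged D u k F.
Proof.
elim: u D s d k => [|i u IH] [A j|A p ts] s d k cl /=.
1,3: case: ltnP => [lt|le] H; first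
  by move: (undischarged_asmP H) => [e -> ->]; rewrite ?e //; split=> //; constructor.
1,2: have c : closed (s [::] (j - d) A) by apply: cl; rewrite subnKC //; exact: undischarged_leaf.
1,2: by case: (@closed_lift d _ c _ _ _ H).
- by case/undischarged_nodeP=> ? [? [? []]].
- case/undischarged_nodeP=> _ [t [_ [[<- <-]]]].
  rewrite onth_mapi; case E: (onth ts i) => [t'|] //= [<-] /IH[].
    by move=> v j B hv; apply: cl; econstructor; eauto.
  by move=> lt h; split=> //; econstructor; eauto.
Qed.

Lemma closed_instance D s :
  (forall u k F, undischarged D u k F -> closed (s u)) -> closed (instance D s).
Proof. by move=> cl u k F /undischarged_subst[] // v j A /cl. Qed.

Lemma concl_lift m d D : concl (lift m d D) = concl D.
Proof. by case: D. Qed.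

Lemma concl_instance D s :
  (forall u k F, undischarged D u k F -> concl (s u) = F) ->
  concl (instance D s) = concl D.
Proof.
case: D => //= A k h; rewrite /instance /= concl_lift; apply: (h _ k).
exact: undischarged_leaf.
Qed.

Lemma replaced_spec E E' D D' : replaced E E' D D' ->
  concl E' = concl E ->
  (forall k F, (exists u, undischarged E' u k F) -> exists u, undischarged E u k F) ->
  concl D' = concl D /\
  forall k F, (exists u, undischarged D' u k F) -> exists u, undischarged D u k F.
Proof.
move=> H cE uE; elim: H => //= A p ts1 ts2 t t' _ [_ IH]; split=> // k F [u H].
case/undischarged_nodeP: H => i [t0 [v [_ e h]]].
move: e; rewrite onth_cat; case: ltnP => [lt|le] e.
  by exists (i :: v); econstructor; [rewrite onth_cat lt; exact: e|].
case j: (i - size ts1) e => [|j'] /= e.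
  case: e => e; subst t0.
  have [w hw] := IH k.+1 F (ex_intro _ _ h).
  by exists (i :: w); econstructor; [rewrite onth_cat ltnNge le j|].
by exists (i :: v); econstructor; [rewrite onth_cat ltnNge le j; exact: e|].
Qed.

Lemma reduces_spec J D D' : is_redset J -> reduces J D D' ->
  concl D' = concl D /\ (closed D -> closed D').
Proof.
move=> rJ; elim=> {D D'} [D D'|//|D1 D2 D3 _ [c1 h1] _ [c2 h2]]; last first.
  by split; [congruence|auto].
case=> phi [E [E' [/rJ [R _ r] e h]]].
have [h1 h2] := reduction_from_to r e.
have [c u] := replaced_spec h h1 h2; split=> // cl v k F h'.
by have [w /cl] := u k F (ex_intro _ v h').
Qed.

Lemma nvalid_closed n B J D :
  closed D -> nvalid n B J D <-> closed_valid n (concl D) B J D.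
Proof. by move=> cl; split=> [[h _]|h]; [exact: h | split]. Qed.

Lemma nvalid_atomic n B J D : closed D -> atomic (concl D) ->
  nvalid n B J D <-> exists2 D', reduces J D D' & closed_derivation B D'.
Proof. by move=> cl at_; rewrite nvalid_closed //; case: (concl D) at_. Qed.

Lemma nvalid_nonatomic n B J D : is_redset J -> closed D -> ~~ atomic (concl D) ->
  nvalid n B J D <->
  exists D', [/\ reduces J D D', canonical D'
               & forall t, t \in children D' -> nvalid n B J t].
Proof.
move=> rJ cl na; rewrite nvalid_closed //.
have clch A ts u F k t : t \in ts -> closed (Node A None ts) -> undischarged t u k F ->
    k = 0.
  move=> tin c h; case: k h => // k h.
  have e : onth ts (index t ts) = Some t.
    by rewrite onthE (nth_map t) ?index_mem // nth_index.
  by case: (c (index t ts :: u) k F); econstructor; eauto.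
have ndch A ts t : t \in ts -> closed (Node A None ts) -> no_discharge t -> closed t.
  by move=> tin c [nd _] u k F h; move: (h); rewrite (clch _ _ _ _ _ _ tin c h) => /nd.
have impv t A : canonical (Node (Imp A (concl t)) None [:: t]) ->
    closed (Node (Imp A (concl t)) None [:: t]) ->
    nvalid n B J t <->
    valid_from n (fun=> closed_valid n A) (closed_valid n (concl t)) B J t.
  move=> ca c.
  have e u k F : undischarged t u k F -> F = A.
    move=> h; move: (h); rewrite (clch _ _ _ _ _ _ (mem_head _ _) c h).
    by inversion ca; eauto.
  split=> -[h1 h2]; split=> // nc s J' C jj rj ext h; apply: h2 => // u k F hu;
    have [? ? ? ?] := h _ _ _ hu; split=> //; move: (hu) => /e E; by subst.
have nv A ts t : t \in ts -> closed (Node A None ts) -> no_discharge t ->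
    nvalid n B J t <-> closed_valid n (concl t) B J t.
  by move=> tin c nd; apply: nvalid_closed; apply: ndch tin c nd.
split.
  case E: (concl D) na => [a|A1 A2|A1 A2|A1 A2] // _ /=.
  - case=> D1 [D2 [r ca v1 v2]]; exists (Node (And A1 A2) None [:: D1; D2]); split=> // t tin.
    have c := (reduces_spec rJ r).2 cl; apply/(nv _ _ _ tin c);
      by inversion ca; subst; move: tin; rewrite !inE => /orP[]/eqP ->.
  - case=> D1 [r ca v]; exists (Node (Or A1 A2) None [:: D1]); split=> // t tin.
    have c := (reduces_spec rJ r).2 cl.
    apply/(nv _ _ _ tin c); move: tin; rewrite inE => /eqP->; first by inversion ca.
    by case: v => -[->].
  - case=> D1 [r ca v]; exists (Node (Imp A1 A2) None [:: D1]); split=> // t.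
    have c := (reduces_spec rJ r).2 cl.
    rewrite inE => /eqP->; have e : A2 = concl D1 by inversion ca.
    by subst A2; apply/(impv _ _ ca c).
case=> D' [r ca h]; have [e c] := reduces_spec rJ r; move/(_ cl): c => c.
have i1 (D1 D2 : struct) : D1 \in [:: D1; D2] by rewrite !inE eqxx.
have i2 (D1 D2 : struct) : D2 \in [:: D1; D2] by rewrite !inE eqxx orbT.
case: D' / ca r h e c => [D1 D2 n1 n2|D1 A2 n1|A1 D2 n2|A D1 n1 n2] r h /= <- c /=.
- exists D1, D2; split=> //; first by constructor.
    by apply/(nv _ _ _ (i1 _ _) c n1)/h/i1.
  by apply/(nv _ _ _ (i2 _ _) c n2)/h/i2.
- exists D1; split=> //; first by constructor.
  by left; split=> //; apply/(nv _ _ _ (mem_head _ _) c n1)/h/mem_head.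
- exists D2; split=> //; first by constructor.
  by right; split=> //; apply/(nv _ _ _ (mem_head _ _) c n2)/h/mem_head.
- exists D1; split=> //; first by constructor.
  by apply/impv => //; [constructor|apply/h/mem_head].
Qed.

Lemma nvalid_open n B J D : ~ closed D ->
  nvalid n B J D <->
  forall (s : seq nat -> struct) (J' : redset) (C : base),
    (forall phi, J phi -> J' phi) -> is_redset J' -> extends n C B ->
    (forall u k F, undischarged D u k F ->
       [/\ wf (s u), closed (s u), concl (s u) = F & nvalid n C J' (s u)]) ->
    nvalid n C J' (instance D s).
Proof.
move=> nc.
have inst (s : seq nat -> struct) J' C :
    (forall u k F, undischarged D u k F ->
       [/\ wf (s u), closed (s u), concl (s u) = F & nvalid n C J' (s u)]) ->
    nvalid n C J' (instance D s) <-> closed_valid n (concl D) C J' (instance D s).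
  move=> hs; rewrite -(@concl_instance D s) => [|u k F /hs[]//].
  by apply: nvalid_closed; apply: closed_instance => u k F /hs[].
split=> [[_ h] s J' C jj rj ext hs|h].
  apply/inst => //; apply: h => // u k F /hs[w c <- v].
  by split=> //; apply/(nvalid_closed _ _ _ c).
split=> // _ s J' C jj rj ext hs.
have hs' u k F : undischarged D u k F ->
    [/\ wf (s u), closed (s u), concl (s u) = F & nvalid n C J' (s u)].
  by move=> /hs[w c <- v]; split=> //; apply/(nvalid_closed _ _ _ c).
by apply/(inst _ _ _ hs'); exact: h.
Qed.

Definition a_entails_on (n : nat) (B : base) (G : seq formula) (A : formula) : Prop :=
  exists D J, [/\ wf D, is_redset J, from_to D G A & nvalid n B J D].

Definition a_entails (n : nat) (G : seq formula) (A : formula) : Prop :=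
  exists D J, [/\ wf D, is_redset J, from_to D G A &
                  forall B, in_bases n B -> nvalid n B J D].

(** * Systems *)

(** [([:: (G1, A1); ...; (Gm, Am)], A)] is the instance ([G1]A1, ..., [Gm]Am)/A
    of a logical rule, which discharges G1, ..., Gm. *)
Definition linst := (seq (seq formula * formula) * formula)%type.

Inductive IL_rule : linst -> Prop :=
| IL_andI A B : IL_rule ([:: ([::], A); ([::], B)], And A B)
| IL_andE1 A B : IL_rule ([:: ([::], And A B)], A)
| IL_andE2 A B : IL_rule ([:: ([::], And A B)], B)
| IL_orI1 A B : IL_rule ([:: ([::], A)], Or A B)
| IL_orI2 A B : IL_rule ([:: ([::], B)], Or A B)
| IL_orE A B C : IL_rule ([:: ([::], Or A B); ([:: A], C); ([:: B], C)], C)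
| IL_impI A B : IL_rule ([:: ([:: A], B)], Imp A B)
| IL_impE A B : IL_rule ([:: ([::], Imp A B); ([::], A)], B)
| IL_botE A : IL_rule ([:: ([::], Atom Bot)], A).

(** [ext_derives L B G A]: there is an extended derivation from (assumptions
    among) G to A with the logical inferences L whose undischarged atomic rules
    are in B. *)
Inductive ext_derives (L : linst -> Prop) :
    (arule -> Prop) -> seq formula -> formula -> Prop :=
| ext_assumption B G A : A \in G -> ext_derives L B G A
| ext_logical B G ps A :
    L (ps, A) -> (forall x, x \in ps -> ext_derives L B (x.1 ++ G) x.2) ->
    ext_derives L B G A
| ext_atomic B G ps a :
    B (Rule ps a) ->
    (forall x, x \in ps ->
       ext_derives L (fun R => B R \/ R \in x.1) G (Atom x.2)) ->
    ext_derives L B G (Atom a).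

(** A recursive set of rules is a sequence of sets of instances [sys_rule i]
    which is uniformly recursive in i. *)
Record system := System {
  sys_rule : nat -> linst -> Prop;
  sys_recursive : recursive (fun x : nat * linst => sys_rule x.1 x.2);
  sys_superint : forall G A,
    ext_derives IL_rule (fun=> False) G A ->
    ext_derives (fun x => exists i, sys_rule i x) (fun=> False) G A
}.

Definition sys_derives (S : system) (B : base) : seq formula -> formula -> Prop :=
  ext_derives (fun x => exists i, sys_rule S i x) B.

Definition base_complete (S : system) (n : nat)
    (entails_on : base -> seq formula -> formula -> Prop) : Prop :=
  forall B, in_bases n B -> forall G A, entails_on B G A -> sys_derives S B G A.

Definition base_sound (S : system) (n : nat)
    (entails_on : base -> seq formula -> formula -> Prop) : Prop :=
  forall B, in_bases n B -> forall G A, sys_derives S B G A -> entails_on B G A.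

(* Main.v *)
Require Import Defs.
From mathcomp Require Import all_boot.
From Stdlib Require Import Classical.
From Stdlib Require Relation_Operators.

(** Let S be base-complete over Sandqvist's semantics and base-sound over the
    reducibility semantics at level n.  On every base of level at most n,
    Sandqvist consequence then implies reducibility consequence, through
    derivability in S ([a_entails_on_of_s_entails_on]).

    For the logical notions, from left to right one applies this on the least
    base, that of the explosion rules alone.  It gives an argument valid there,
    and validity persists when the base is extended ([nvalid_mono]): the same
    argument is valid on all bases.

    From right to left, one first shows for each formula A that if some closed
    argument for A is valid on B then A is true on B in Sandqvist's sense
    ([s_true_of_closed_valid]), by induction on A.  Only implication needs S: if
    A1 is true on an extension C of B, then S yields a closed argument for A1
    valid on C; a valid argument for the implication reduces to an introduction,
    whose immediate sub-structure is filled with that closed argument, and the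
    induction hypothesis applies to the result.  Consequence from G is treated
    likewise, with closed arguments for the members of G substituted for the
    undischarged assumptions.  Arguments with different sets of reductions are
    combined by passing to the set of all reductions, since validity persists
    when reductions are added. *)

Set Implicit Arguments.
Unset Strict Implicit.
Unset Printing Implicit Defensive.

(* So that [closed] is the predicate on argument structures, not the one on graphs. *)
Import Defs.

Lemma extends_trans n (E C B : base) :
  extends n E C -> extends n C B -> extends n E B.
Proof. by move=> [EC En] [CB _]; split=> // R /CB/EC. Qed.

Lemma extends_refl n (C B : base) : extends n C B -> extends n C C.
Proof. by case. Qed.

Lemma derivation_mono (B C : base) l D :
  (forall R, B R -> C R) -> derivation B l D -> derivation C l D.
Proof.
move=> BC; elim=> {D} {}l ps a p ts hp e _ IH; apply: (derivation_rule _ e) => //.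
by case: p hp => // /BC.
Qed.

Lemma reduces_mono (J J' : redset) D E :
  (forall phi, J phi -> J' phi) -> reduces J D E -> reduces J' D E.
Proof.
move=> JJ; elim=> {D E} [D E [phi [F [F' [/JJ Jphi e h]]]]|D|D1 D2 D3 _ h1 _ h2].
- by apply: Relation_Operators.rt_step; exists phi, F, F'.
- exact: Relation_Operators.rt_refl.
- exact: Relation_Operators.rt_trans h1 h2.
Qed.

Lemma valid_from_mono n V (W : base -> redset -> struct -> Prop) (B C : base)
    (J J' : redset) D :
  (W B J D -> W C J' D) -> (forall phi, J phi -> J' phi) -> extends n C B ->
  valid_from n V W B J D -> valid_from n V W C J' D.
Proof.
move=> WW JJ ext [h1 h2]; split=> [/h1/WW //|nc s K E JK rK EC].
apply: h2 => //; first by move=> phi /JJ/JK.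
exact: extends_trans EC ext.
Qed.

Lemma closed_valid_mono n A (B C : base) (J J' : redset) D :
  (forall phi, J phi -> J' phi) -> extends n C B ->
  closed_valid n A B J D -> closed_valid n A C J' D.
Proof.
move=> JJ ext; elim: A D => [a|A1 IH1 A2 IH2|A1 IH1 A2 IH2|A1 _ A2 IH2] D /=.
- case=> D' r d; exists D'; first exact: reduces_mono r.
  exact: derivation_mono (proj1 ext) d.
- case=> D1 [D2 [r ca v1 v2]]; exists D1, D2.
  by split; [exact: reduces_mono r| |exact: IH1|exact: IH2].
- case=> D1 [r ca v]; exists D1; split=> //; first exact: reduces_mono r.
  by case: v => -[e v]; [left|right]; split=> //; [exact: IH1|exact: IH2].
- case=> D1 [r ca v]; exists D1; split=> //; first exact: reduces_mono r.
  by apply: valid_from_mono v => // /IH2.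
Qed.

Lemma nvalid_mono n (B C : base) (J : redset) D :
  extends n C B -> nvalid n B J D -> nvalid n C J D.
Proof. by move=> ext; apply: valid_from_mono => //; apply: closed_valid_mono. Qed.

(** The least base, which consists of the explosion rules. *)
Definition explosion_base : base := fun R => exists a, R = explosion a.

Lemma explosion_base_in_bases n : in_bases n explosion_base.
Proof.
split; last by move=> R [a ->] /(_ a).
split=> [a|R Q RQ [b e]]; first by exists a.
case: R Q / RQ e => ps qs a e2 _ sub [eps ea]; subst ps; exists b; rewrite -ea.
case: qs e2 sub => [|[Rs c] [|? ?]] //= [<-] sub.
case: Rs sub => // Q Rs /(_ (([::], Bot), (Q :: Rs, Bot))).
(* A rule discharged above the premise would match one discharged in an
   explosion rule, where there is none. *)
by case/(_ (mem_head _ _) Q (mem_head _ _)).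
Qed.

Lemma extends_explosion_base n B : in_bases n B -> extends n B explosion_base.
Proof. by move=> Bn; split=> // R [a ->]; case: Bn => -[]. Qed.

Lemma from_to_nil D A : from_to D [::] A -> closed D.
Proof. by case=> h _ u k F hu; have /h : exists u k, undischarged D u k F by exists u, k. Qed.

(** The label of the assumption leaf at node u of D; elsewhere the value is
    irrelevant. *)
Fixpoint label_at (D : struct) (u : seq nat) : formula :=
  match u, D with
  | i :: u', Node A _ ts => nth A [seq label_at t u' | t <- ts] i
  | _, _ => concl D
  end.

Lemma undischarged_label D u k F : undischarged D u k F -> label_at D u = F.
Proof.
elim=> {D u k F} //= B p ts i t u k F e _ <-.
have lt : i < size ts by rewrite -onthTE e.
rewrite (nth_map t) //; congr (label_at _ u).
by move: e; rewrite onthE (nth_map t) // => -[].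
Qed.

Lemma closed_premise A ts t :
  closed (Node A None ts) -> t \in ts -> no_discharge t -> closed t.
Proof.
move=> cl tin [nd _] u [|k] F hu; first exact: nd hu.
have e : onth ts (index t ts) = Some t.
  by rewrite onthE (nth_map t) ?index_mem // nth_index.
by case: (cl (index t ts :: u) k F); econstructor; eauto.
Qed.

(** The undischarged assumptions of the premise of an introduction of A -> B
    with no undischarged assumption are all labelled A. *)
Lemma closed_imp_intro_premise A B D :
  canonical (Node (Imp A B) None [:: D]) -> closed (Node (Imp A B) None [:: D]) ->
  forall u k F, undischarged D u k F -> F = A.
Proof.
move=> ca cl u [|k] F hu; first by inversion ca; eauto.
by case: (cl (0 :: u) k F); econstructor; eauto.
Qed.

Lemma a_entails_on_of_s_entails_on S n B G A :
  base_complete S n (s_entails_on n) -> base_sound S n (a_entails_on n) ->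
  in_bases n B -> s_entails_on n B G A -> a_entails_on n B G A.
Proof. by move=> comp sound Bn h; apply: sound => //; apply: comp. Qed.

(** True formulas have valid closed arguments whose reductions are all the
    reductions. *)
Lemma closed_valid_of_s_true S n A (B : base) :
  base_complete S n (s_entails_on n) -> base_sound S n (a_entails_on n) ->
  in_bases n B -> s_true n A B ->
  exists D, [/\ wf D, closed D, concl D = A & closed_valid n A B reduction D].
Proof.
move=> complete sound Bn tA.
have [D [J [wD rJ ft v]]] :=
  @a_entails_on_of_s_entails_on S n B [::] A complete sound Bn tA.
have cl := from_to_nil ft; case: ft => _ e; exists D; split=> //.
apply: (@closed_valid_mono _ _ B B J) => //.
by rewrite -e; apply/(nvalid_closed _ _ _ cl).
Qed.

(** The induction is on A; the structure and the set of reductions vary with the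
    base, since instances of sub-structures of D occur in the case of
    implication. *)
Lemma s_true_of_closed_valid S n A (B : base) (J : redset) D :
  base_complete S n (s_entails_on n) -> base_sound S n (a_entails_on n) ->
  in_bases n B -> is_redset J -> closed D -> concl D = A ->
  closed_valid n A B J D -> s_true n A B.
Proof.
move=> complete sound.
elim: A B J D => [a|A1 IH1 A2 IH2|A1 IH1 A2 IH2|A1 _ A2 IH2] B J D Bn rJ cl e /=.
- case=> D' r d; have [e' _] := reduces_spec rJ r.
  by exists D' => //; rewrite e'.
- case=> D1 [D2 [r ca v1 v2]].
  have c := (reduces_spec rJ r).2 cl.
  have [n1 n2 e1 e2] : [/\ no_discharge D1, no_discharge D2, concl D1 = A1 & concl D2 = A2].
    by inversion ca.
  split; [apply: IH1 v1 => //|apply: IH2 v2 => //]; apply: (closed_premise c) => //;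
    by rewrite !inE eqxx ?orbT.
- case=> D1 [r ca v] C ext a h1 h2.
  have c := (reduces_spec rJ r).2 cl.
  have nd : no_discharge D1 by inversion ca.
  have c1 : closed D1 by apply: (closed_premise c) nd; exact: mem_head.
  have Cn := proj2 ext; have CC := extends_refl ext.
  case: v => -[e1 /(@closed_valid_mono _ _ _ C _ J _ (fun _ => id) ext) v].
  + by apply: h1 => //; exact: IH1 v.
  + by apply: h2 => //; exact: IH2 v.
- case=> D1 [r ca v] C ext t1.
  have c := (reduces_spec rJ r).2 cl.
  have lab := closed_imp_intro_premise ca c.
  have e2 : concl D1 = A2 by inversion ca.
  have Cn := proj2 ext.
  have [D2 [w2 c2 e1 v1]] := closed_valid_of_s_true complete sound Cn t1.
  case: v => v_closed v_open.
  (* D1 is closed when the introduction discharges vacuously; the argument for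
     A1 is then not needed. *)
  case: (classic (closed D1)) => [c1|nc1].
    apply: (IH2 C J D1) => //.
    exact: (@closed_valid_mono _ _ B C J J D1 (fun _ => id) ext (v_closed c1)).
  apply: (IH2 C reduction (instance D1 (fun=> D2))) => //.
  + by apply: closed_instance.
  + by rewrite concl_instance // => u k F /lab->.
  + by apply: v_open => // u k F /lab->.
Qed.

Lemma s_entails_on_of_nvalid S n B (J : redset) D G A :
  base_complete S n (s_entails_on n) -> base_sound S n (a_entails_on n) ->
  in_bases n B -> is_redset J -> from_to D G A -> nvalid n B J D ->
  s_entails_on n B G A.
Proof.
move=> complete sound.
case: G => [|F0 G] Bn rJ ft v.
  have cl := from_to_nil ft; case: ft => _ e.
  apply: (s_true_of_closed_valid complete sound Bn rJ cl e).
  by rewrite -e; apply/(nvalid_closed _ _ _ cl).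
move=> C ext tG; have Cn := proj2 ext.
have [arg argP] : exists arg : formula -> struct, forall F, F \in F0 :: G ->
    [/\ wf (arg F), closed (arg F), concl (arg F) = F
      & closed_valid n F C reduction (arg F)].
  (* The value at formulas outside of the list is irrelevant. *)
  elim: (F0 :: G) tG => [|F L IH] tL; first by exists (Asm^~ 0).
  have [D1 h1] := closed_valid_of_s_true complete sound Cn (tL F (mem_head _ _)).
  have [|arg h] := IH; first by move=> F' hF'; apply: tL; rewrite inE hF' orbT.
  exists (fun F' => if F' == F then D1 else arg F') => F'.
  by rewrite inE; case: eqP => [->|_] // /h.
case: ft => und e.
have nc : ~ closed D.
  by move=> cl; have [u [k /cl]] := proj1 (und F0) (mem_head _ _).
have hs u k F : undischarged D u k F ->
    [/\ wf (arg (label_at D u)), closed (arg (label_at D u)),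
        concl (arg (label_at D u)) = F
      & closed_valid n F C reduction (arg (label_at D u))].
  by move=> hu; rewrite (undischarged_label hu); apply/argP/und; exists u, k.
apply: (@s_true_of_closed_valid S n A C reduction (instance D (arg \o label_at D))) => //.
- by apply: closed_instance => u k F /hs[].
- by rewrite concl_instance // => u k F /hs[].
- by rewrite -e; apply: (proj2 v).
Qed.

Theorem theorem13 (n : nat) :
  (exists S : system, base_complete S n (s_entails_on n) /\
                      base_sound S n (a_entails_on n)) ->
  forall (G : seq formula) (A : formula), s_entails n G A <-> a_entails n G A.
Proof.
case=> S [complete sound] G A; split=> [h|[D [J [_ rJ ft v]]] B Bn].
- have E := explosion_base_in_bases n.
  have [D [J [wD rJ ft v]]] := a_entails_on_of_s_entails_on complete sound E (h _ E).
  exists D, J; split=> // B Bn.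
  exact: nvalid_mono (extends_explosion_base Bn) v.
- exact: (s_entails_on_of_nvalid complete sound Bn rJ ft (v B Bn)).
Qed.
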